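(* Let $\bar x$ belong to the feasible region $\Omega_C$ of the MPCC (see context) and assume that GGCQ is fulfilled at $\bar x$. Further assume that there is some partition $(\beta^{GH}_1,\beta^{GH}_2)$ of the index set $\beta^{GH}$ such that for every $\mu=(\mu^h,\mu^g,\mu^G,\mu^H)\in\mathcal N_{CC}$ there holds \begin{align*} &\mu_i^G\mu_{i'}^G\geq 0,\ \mu_i^H\mu_{i'}^H\geq 0\quad \forall (i,i')\in\beta^{GH}_1\times\beta^{GH}_2,\\ &\mu_i^G\mu_{i'}^H\geq 0\quad \forall (i,i')\in\beta^{GH}_1\times\beta^{GH}_1,\\ &\mu_i^G\mu_{i'}^H\geq 0\quad \forall (i,i')\in\beta^{GH}_2\times\beta^{GH}_2. \end{align*} Then $$\widehat N_{\Omega_C}(\bar x)=\nabla F(\bar x)^T\widehat N_D(F(\bar x)).$$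
   Context: For $\Gamma\subset\mathbb{R}^d$, $\bar z\in\Gamma$: $T_\Gamma(\bar z)=\{u\mid \exists t_k\searrow 0,\ u_k\to u:\ \bar z+t_ku_k\in\Gamma\ \forall k\}$, $\widehat N_\Gamma(\bar z)=(T_\Gamma(\bar z))^\circ$, where $K^\circ=\{z^*\mid \langle z^*,u\rangle\le 0\ \forall u\in K\}$. MPCC: minimize $f(x)$ subject to $h(x)=0$, $g(x)\le 0$, $0\le G(x)\perp H(x)\ge 0$, with $f:\mathbb{R}^n\to\mathbb{R}$, $h:\mathbb{R}^n\to\mathbb{R}^{m_E}$, $g:\mathbb{R}^n\to\mathbb{R}^{m_I}$, $G,H:\mathbb{R}^n\to\mathbb{R}^{m_C}$ continuously differentiable. Its feasible set is $\Omega_C=\{x\mid F(x)\in D\}$ with $F(x)=(h(x),g(x),-G_1(x),-H_1(x),\ldots,-G_{m_C}(x),-H_{m_C}(x))$, $D=\{0\}^{m_E}\times\mathbb{R}_-^{m_I}\times D_C^{m_C}$, $D_C=\{(a,b)\in\mathbb{R}_-^2\mid ab=0\}$. GGCQ at $\bar x$: $(T_{\Omega_C}(\bar x))^\circ=\{u\mid\nabla F(\bar x)u\in T_D(F(\bar x))\}^\circ$. Index sets: $I^g=\{i\mid g_i(\bar x)=0\}$, $I^{0+}=\{i\mid G_i(\bar x)=0<H_i(\bar x)\}$, $I^{00}=\{i\mid G_i(\bar x)=0=H_i(\bar x)\}$, $I^{+0}=\{i\mid G_i(\bar x)>0=H_i(\bar x)\}$. Let \begin{align*} \mathcal R_{CC}=\{(\mu^h,\mu^g,\mu^G,\mu^H)\in\mathbb{R}^{m_E}\times\mathbb{R}^{m_I}\times\mathbb{R}^{m_C}\times\mathbb{R}^{m_C}\mid\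 &\mu_i^g=0,\ i\notin I^g;\ \mu_i^G=0,\ i\in I^{+0};\ \mu_i^H=0,\ i\in I^{0+}\}, \end{align*} $$\mathcal N_{CC}=\Big\{\mu\in\mathcal R_{CC}\ \Big|\ \sum_{i=1}^{m_E}\mu_i^h\nabla h_i(\bar x)+\sum_{i=1}^{m_I}\mu_i^g\nabla g_i(\bar x)-\sum_{i=1}^{m_C}(\mu_i^G\nabla G_i(\bar x)+\mu_i^H\nabla H_i(\bar x))=0\Big\}.$$ The set $\beta^{GH}$: consider the linear system in $u\in\mathbb{R}^n$ \begin{align*} &\nabla h(\bar x)u=0,\quad \nabla g_i(\bar x)u\le 0,\ i\in I^g,\quad -\nabla G_i(\bar x)u=0,\ i\in I^{0+},\quad -\nabla H_i(\bar x)u=0,\ i\in I^{+0},\\ &-\nabla G_i(\bar x)u\le 0,\ -\nabla H_i(\bar x)u\le 0,\ i\in I^{00}. \end{align*} An inequality of this system is called nonsingular if there is a solution of the system satisfying that inequality strictly. Let $\beta^G$ (resp. $\beta^H$) be the set of $i\in I^{00}$ such that the inequality $-\nabla G_i(\bar x)u\le 0$ (resp. $-\nabla H_i(\bar x)u\le 0$) is nonsingular, and $\beta^{GH}:=\beta^G\cap\beta^H$. A partition $(\beta_1^{GH},\beta_2^{GH})$ of $\beta^{GH}$ consists of two disjoint (possibly empty) sets with union $\beta^{GH}$. *)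

(* Defs.v *)
(* Vectors of R^d are row vectors of type 'rV[R]_d. *)
From mathcomp Require Import all_boot all_order all_algebra.
From mathcomp Require Import all_classical all_reals.
From mathcomp Require Import topology normedtype sequences derive.
Set Implicit Arguments.
Unset Strict Implicit.
Unset Printing Implicit Defensive.
Import Order.TTheory GRing.Theory Num.Theory.
Import numFieldNormedType.Exports.
Local Open Scope classical_set_scope.
Local Open Scope ring_scope.

Definition dot (R : realType) (d : nat) (a b : 'rV[R]_d) : R :=
  \sum_(j < d) a 0 j * b 0 j.

Definition polar (R : realType) (d : nat) (K : set 'rV[R]_d) : set 'rV[R]_d :=
  [set zs | forall u, K u -> dot zs u <= 0].

(* The Bouligand (contingent) cone; t_k \searrow 0 means t_k > 0, t_k --> 0. *)
Definition tangent_cone (R : realType) (d : nat) (Gamma : set 'rV[R]_d)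
    (z : 'rV[R]_d) : set 'rV[R]_d :=
  [set u | exists (t : nat -> R) (v : nat -> 'rV[R]_d),
     [/\ forall k, 0 < t k,
         t @ \oo --> (0 : R),
         v @ \oo --> u &
         forall k, Gamma (z + t k *: v k)]].

Definition regular_normal_cone (R : realType) (d : nat)
    (Gamma : set 'rV[R]_d) (z : 'rV[R]_d) : set 'rV[R]_d :=
  polar (tangent_cone Gamma z).

(* As the domain is finite-dimensional, continuity of x |-> 'd f x v for every
   v is continuity of x |-> 'd f x. *)
Definition continuously_differentiable (R : realType) (n : nat)
    (W : normedModType R) (f : 'rV[R]_n -> W) : Prop :=
  (forall x, differentiable f x) /\
  (forall v : 'rV[R]_n, continuous (fun x => 'd f x v)).

(* [jacobian] acts on row vectors from the right; its transpose is the usual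
   m x n Jacobian matrix, whose rows are the gradients of the components. *)
Definition nabla (R : realType) (n m : nat) (f : 'rV[R]_n -> 'rV[R]_m)
    (x : 'rV[R]_n) : 'M[R]_(m, n) := (jacobian f x)^T.

Definition grad (R : realType) (n m : nat) (f : 'rV[R]_n -> 'rV[R]_m)
    (i : 'I_m) (x : 'rV[R]_n) : 'rV[R]_n := row i (nabla f x).

(* [mxvec] is row-major, so the last block is
   (- G_1, - H_1, ..., - G_mC, - H_mC). *)
Definition mpcc_F (R : realType) (n mE mI mC : nat)
    (h : 'rV[R]_n -> 'rV[R]_mE) (g : 'rV[R]_n -> 'rV[R]_mI)
    (G H : 'rV[R]_n -> 'rV[R]_mC) (x : 'rV[R]_n) : 'rV[R]_(mE + mI + mC * 2) :=
  row_mx (row_mx (h x) (g x))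
    (mxvec (\matrix_(i < mC, j < 2)
              (if j == 0 then - G x 0 i else - H x 0 i))).

Definition D_C (R : realType) : set (R * R) :=
  [set ab | [/\ ab.1 <= 0, ab.2 <= 0 & ab.1 * ab.2 = 0]].

Definition mpcc_D (R : realType) (mE mI mC : nat) :
    set 'rV[R]_(mE + mI + mC * 2) :=
  [set y | [/\ lsubmx (lsubmx y) = 0,
               forall i : 'I_mI, rsubmx (lsubmx y) 0 i <= 0 &
               forall i : 'I_mC,
                 D_C (vec_mx (rsubmx y) i 0, vec_mx (rsubmx y) i 1)]].
Arguments mpcc_D : clear implicits.

Definition Omega_C (R : realType) (n mE mI mC : nat)
    (h : 'rV[R]_n -> 'rV[R]_mE) (g : 'rV[R]_n -> 'rV[R]_mI)
    (G H : 'rV[R]_n -> 'rV[R]_mC) : set 'rV[R]_n :=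
  [set x | mpcc_D R mE mI mC (mpcc_F h g G H x)].

(* For a row vector u, u *m (nabla F x)^T is the row form of nabla F(x) u. *)
Definition GGCQ (R : realType) (n mE mI mC : nat)
    (h : 'rV[R]_n -> 'rV[R]_mE) (g : 'rV[R]_n -> 'rV[R]_mI)
    (G H : 'rV[R]_n -> 'rV[R]_mC) (x : 'rV[R]_n) : Prop :=
  polar (tangent_cone (Omega_C h g G H) x) =
  polar [set u | tangent_cone (mpcc_D R mE mI mC) (mpcc_F h g G H x)
                   (u *m (nabla (mpcc_F h g G H) x)^T)].

Definition I_g (R : realType) (n mI : nat) (g : 'rV[R]_n -> 'rV[R]_mI)
    (x : 'rV[R]_n) : set 'I_mI := [set i | g x 0 i = 0].

Definition I_0p (R : realType) (n mC : nat) (G H : 'rV[R]_n -> 'rV[R]_mC)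
    (x : 'rV[R]_n) : set 'I_mC := [set i | G x 0 i = 0 /\ 0 < H x 0 i].

Definition I_00 (R : realType) (n mC : nat) (G H : 'rV[R]_n -> 'rV[R]_mC)
    (x : 'rV[R]_n) : set 'I_mC := [set i | G x 0 i = 0 /\ H x 0 i = 0].

Definition I_p0 (R : realType) (n mC : nat) (G H : 'rV[R]_n -> 'rV[R]_mC)
    (x : 'rV[R]_n) : set 'I_mC := [set i | 0 < G x 0 i /\ H x 0 i = 0].

Definition R_CC (R : realType) (n mE mI mC : nat)
    (g : 'rV[R]_n -> 'rV[R]_mI) (G H : 'rV[R]_n -> 'rV[R]_mC) (x : 'rV[R]_n) :
    set ('rV[R]_mE * 'rV[R]_mI * 'rV[R]_mC * 'rV[R]_mC) :=
  [set mu : 'rV[R]_mE * 'rV[R]_mI * 'rV[R]_mC * 'rV[R]_mC |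
     let: (muh, mug, muG, muH) := mu in
     [/\ forall i, ~ I_g g x i -> mug 0 i = 0,
         forall i, I_p0 G H x i -> muG 0 i = 0 &
         forall i, I_0p G H x i -> muH 0 i = 0]].

Definition N_CC (R : realType) (n mE mI mC : nat)
    (h : 'rV[R]_n -> 'rV[R]_mE) (g : 'rV[R]_n -> 'rV[R]_mI)
    (G H : 'rV[R]_n -> 'rV[R]_mC) (x : 'rV[R]_n) :
    set ('rV[R]_mE * 'rV[R]_mI * 'rV[R]_mC * 'rV[R]_mC) :=
  [set mu : 'rV[R]_mE * 'rV[R]_mI * 'rV[R]_mC * 'rV[R]_mC |
     R_CC g G H x mu /\
     let: (muh, mug, muG, muH) := mu in
     \sum_(i < mE) muh 0 i *: grad h i x + \sum_(i < mI) mug 0 i *: grad g i x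
     - \sum_(i < mC) (muG 0 i *: grad G i x + muH 0 i *: grad H i x) = 0].

Definition linear_system (R : realType) (n mE mI mC : nat)
    (h : 'rV[R]_n -> 'rV[R]_mE) (g : 'rV[R]_n -> 'rV[R]_mI)
    (G H : 'rV[R]_n -> 'rV[R]_mC) (x : 'rV[R]_n) : set 'rV[R]_n :=
  [set u | [/\ u *m (nabla h x)^T = 0,
               forall i, I_g g x i -> dot (grad g i x) u <= 0,
               forall i, I_0p G H x i -> - dot (grad G i x) u = 0,
               forall i, I_p0 G H x i -> - dot (grad H i x) u = 0 &
               forall i, I_00 G H x i ->
                 - dot (grad G i x) u <= 0 /\ - dot (grad H i x) u <= 0]].

Definition beta_G (R : realType) (n mE mI mC : nat)
    (h : 'rV[R]_n -> 'rV[R]_mE) (g : 'rV[R]_n -> 'rV[R]_mI)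
    (G H : 'rV[R]_n -> 'rV[R]_mC) (x : 'rV[R]_n) : set 'I_mC :=
  [set i | I_00 G H x i /\
     exists2 u, linear_system h g G H x u & - dot (grad G i x) u < 0].

Definition beta_H (R : realType) (n mE mI mC : nat)
    (h : 'rV[R]_n -> 'rV[R]_mE) (g : 'rV[R]_n -> 'rV[R]_mI)
    (G H : 'rV[R]_n -> 'rV[R]_mC) (x : 'rV[R]_n) : set 'I_mC :=
  [set i | I_00 G H x i /\
     exists2 u, linear_system h g G H x u & - dot (grad H i x) u < 0].

Definition beta_GH (R : realType) (n mE mI mC : nat)
    (h : 'rV[R]_n -> 'rV[R]_mE) (g : 'rV[R]_n -> 'rV[R]_mI)
    (G H : 'rV[R]_n -> 'rV[R]_mC) (x : 'rV[R]_n) : set 'I_mC :=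
  beta_G h g G H x `&` beta_H h g G H x.

(* The blocks may be empty. *)
Definition bipartition (T : Type) (A B1 B2 : set T) : Prop :=
  B1 `&` B2 = set0 /\ B1 `|` B2 = A.

(* Main.v *)
From HB Require Import structures.
Require Import Defs.
From mathcomp Require Import all_boot all_order all_algebra.
From mathcomp Require Import all_classical all_reals.
From mathcomp Require Import topology normedtype sequences derive.
Import Order.TTheory GRing.Theory Num.Theory.
Import numFieldNormedType.Exports.
Local Open Scope classical_set_scope.
Local Open Scope ring_scope.

Set Implicit Arguments.
Unset Strict Implicit.
Unset Printing Implicit Defensive.

(** The generalized Guignard condition replaces the regular normal cone of the
feasible set by the polar of the linearized cone
  L = { u | (nabla F) u is tangent to D at F(xbar) },
and vectors y *m nabla F with y normal to D always lie in that polar. The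
content is the reverse inclusion: L is not convex, so its polar has to be
controlled through convex pieces.

Let S be the solution set of the linear system, a polyhedral cone containing L.
On S the product of dG_i u and dH_i u vanishes for each i in I^00 outside
beta^GH, because one of the two factors is identically zero there. Hence u in S
belongs to L as soon as the product vanishes for i in beta^GH
([linear_system_tangent]). The partition thus gives two polyhedral cones inside
L: one imposes dG_i u = 0 on beta1 and dH_i u = 0 on beta2, the other one
exchanges the roles of G and H.

A vector w polar to L is polar to both pieces, and Farkas' lemma ([farkas])
writes it as w = y1 *m nabla F = y2 *m nabla F ([branch_multiplier]). The only
sign defects of y1 as a normal to D are negative G-entries on beta1 or negative
H-entries on beta2; those of y2 are negative G-entries on beta2 or negative
H-entries on beta1. The difference y1 - y2 lies in N_CC, so the sign hypothesis
applies to it. If y1 has a defect, the corresponding entry of y1 - y2 is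
negative; the hypothesis then makes y1 - y2 nonpositive at every position where
y2 could have a defect, and there y2 dominates the nonnegative entries of y1.
So y1 or y2 is free of defects ([nonneg_dichotomy]), and it is the required
normal to D ([normal_mpcc_D]). *)

(** * Inner products and Farkas' lemma *)

Lemma dotE (R : realType) d (a b : 'rV[R]_d) : dot a b = (a *m b^T) 0 0.
Proof. by rewrite mxE; apply: eq_bigr => j _; rewrite mxE. Qed.

Lemma dotDl (R : realType) d (a b u : 'rV[R]_d) :
  dot (a + b) u = dot a u + dot b u.
Proof. by rewrite !dotE mulmxDl mxE. Qed.

Lemma dotZl (R : realType) d (c : R) (a u : 'rV[R]_d) :
  dot (c *: a) u = c * dot a u.
Proof. by rewrite !dotE -scalemxAl mxE. Qed.

Lemma dotNl (R : realType) d (a u : 'rV[R]_d) : dot (- a) u = - dot a u.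
Proof. by rewrite -scaleN1r dotZl mulN1r. Qed.

Lemma dotDr (R : realType) d (a u v : 'rV[R]_d) :
  dot a (u + v) = dot a u + dot a v.
Proof. by rewrite !dotE linearD mulmxDr mxE. Qed.

Lemma dotZr (R : realType) d (c : R) (a u : 'rV[R]_d) :
  dot a (c *: u) = c * dot a u.
Proof. by rewrite !dotE linearZ -scalemxAr mxE. Qed.

Lemma dotNr (R : realType) d (a u : 'rV[R]_d) : dot a (- u) = - dot a u.
Proof. by rewrite -scaleN1r dotZr mulN1r. Qed.

Lemma dot0l (R : realType) d (u : 'rV[R]_d) : dot 0 u = 0.
Proof. by rewrite -(scale0r 0) dotZl mul0r. Qed.

Lemma dot_mulmx (R : realType) m d (y : 'rV[R]_m) (A : 'M[R]_(m, d))
    (u : 'rV[R]_d) :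
  dot (y *m A) u = dot y (u *m A^T).
Proof. by rewrite !dotE trmx_mul trmxK mulmxA. Qed.

Lemma dot_row (R : realType) m d (A : 'M[R]_(m, d)) (u : 'rV[R]_d) (j : 'I_m) :
  dot (row j A) u = (u *m A^T) 0 j.
Proof. by rewrite mxE; apply: eq_bigr => k _; rewrite !mxE mulrC. Qed.

(** Induction on the number of generators, with no appeal to topology. If the
implication survives without [a i0], give that generator coefficient zero. Otherwise some [u0] satisfies all other inequalities and has
[dot b u0 > 0], which forces [dot (a i0) u0 > 0]; projecting along [u0] onto the
hyperplane orthogonal to [a i0] reduces to the remaining generators. *)
Lemma farkas_seq (R : realType) (I : eqType) d (r : seq I) (a : I -> 'rV[R]_d)
    (b : 'rV[R]_d) :
  uniq r ->
  (forall u, (forall i, i \in r -> dot (a i) u <= 0) -> dot b u <= 0) ->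
  exists l : I -> R, (forall i, 0 <= l i) /\ b = \sum_(i <- r) l i *: a i.
Proof.
elim: r a b => [|i0 r IHr] a b.
  move=> _ bpolar; exists (fun=> 0); split=> //; rewrite big_nil.
  have : dot b b <= 0 by apply: bpolar => i; rewrite in_nil.
  have bb j : 0 <= b 0 j * b 0 j by rewrite -expr2 sqr_ge0.
  move=> b_le0; have /eqP : dot b b = 0.
    by apply: le_anti; rewrite b_le0 sumr_ge0.
  rewrite psumr_eq0 // => /allP b0; apply/rowP => j; rewrite mxE.
  by have /= := b0 j (mem_index_enum j); rewrite -expr2 sqrf_eq0 => /eqP.
move=> /= /andP[i0r ur] bpolar.
pose polar_tail := forall u, (forall i, i \in r -> dot (a i) u <= 0) ->
  dot b u <= 0.
have big_extend (l : I -> R) (c : R) :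
    \sum_(i <- i0 :: r) (if i == i0 then c else l i) *: a i
    = c *: a i0 + \sum_(i <- r) l i *: a i.
  rewrite big_cons eqxx; congr (_ + _); apply: eq_big_seq => i ir.
  by case: eqP => // ii0; rewrite -ii0 ir in i0r.
case: (pselect polar_tail) => [tail|].
  have [l [l0 ->]] := IHr a b ur tail.
  exists (fun i => if i == i0 then 0 else l i); split=> [i|].
    by case: eqP.
  by rewrite big_extend scale0r add0r.
move=> /existsNP[u0 /not_implyP[au0 /negP]]; rewrite -ltNge => bu0.
have a0u0 : 0 < dot (a i0) u0.
  rewrite ltNge; apply/negP => a0_le0; move: bu0; rewrite ltNge => /negP; apply.
  by apply: bpolar => i; rewrite inE => /predU1P[->//|]; apply: au0.
(* c - k c *: a i0 is the functional u |-> dot c (u projected along u0). *)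
pose k (c : 'rV[R]_d) := dot c u0 / dot (a i0) u0.
have [u|l [l0 bE]] := IHr (fun i => a i - k (a i) *: a i0) (b - k b *: a i0) ur.
  move=> au.
  have shift c : dot (c - k c *: a i0) u
      = dot c (u - (dot (a i0) u / dot (a i0) u0) *: u0).
    rewrite dotDl dotNl dotZl dotDr dotNr dotZr; congr (_ - _).
    by rewrite /k mulrAC [RHS]mulrAC [dot c u0 * _]mulrC.
  rewrite shift; apply: bpolar => i; rewrite inE => /predU1P[->|ir].
    by rewrite -shift /k divff ?gt_eqF // scale1r subrr dot0l.
  by rewrite -shift; apply: au.
(* c0 >= 0: k b > 0 by choice of u0, and k (a i) <= 0 for i in r. *)
pose c0 := k b - \sum_(i <- r) l i * k (a i).
exists (fun i => if i == i0 then c0 else l i); split=> [i|].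
  case: eqP => // _; rewrite subr_ge0 (@le_trans _ _ 0) //.
    rewrite big_seq sumr_le0 // => j jr; rewrite mulr_ge0_le0 //.
    by rewrite /k pmulr_lle0 ?invr_gt0 // au0.
  by rewrite divr_ge0 // ltW.
rewrite big_extend -[LHS](subrK (k b *: a i0)) bE addrC.
rewrite /c0 scalerBl -addrA; congr (_ + _).
rewrite scaler_suml addrC -sumrB.
by apply: eq_bigr => i _; rewrite scalerBr scalerA.
Qed.

Lemma farkas (R : realType) m d (A : 'M[R]_(m, d)) (eqs ineqs : pred 'I_m)
    (x : 'rV[R]_d) :
  (forall u, (forall j, eqs j -> dot (row j A) u = 0) ->
     (forall j, ineqs j -> dot (row j A) u <= 0) -> dot x u <= 0) ->
  exists y : 'rV[R]_m, [/\ x = y *m A,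
    forall j, ~~ eqs j -> 0 <= y 0 j &
    forall j, ~~ eqs j -> ~~ ineqs j -> y 0 j = 0].
Proof.
move=> xpolar.
(* An equality is a pair of opposite inequalities. *)
pose a (bj : bool * 'I_m) : 'rV[R]_d :=
  if bj.1 then (if eqs bj.2 || ineqs bj.2 then row bj.2 A else 0)
  else (if eqs bj.2 then - row bj.2 A else 0).
have [|u au|l [l0 ->]] := @farkas_seq R _ d (index_enum (bool * 'I_m)%type) a x.
- exact: index_enum_uniq.
- apply: xpolar => j.
    move=> ej; apply/eqP; rewrite eq_le; apply/andP; split.
      by have := au (true, j) (mem_index_enum _); rewrite /a /= ej.
    by have := au (false, j) (mem_index_enum _); rewrite /a /= ej dotNl oppr_le0.
  by move=> ij; have := au (true, j) (mem_index_enum _); rewrite /a /= ij orbT.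
exists (\row_j ((if eqs j || ineqs j then l (true, j) else 0)
              - (if eqs j then l (false, j) else 0))); split.
- rewrite mulmx_sum_row.
  under eq_bigr do rewrite [X in l X *: a X]surjective_pairing.
  rewrite -(pair_bigA _ (fun b j => l (b, j) *: a (b, j))) /=.
  rewrite big_bool -big_split /=; apply: eq_bigr => j _.
  rewrite mxE /a /= scalerBl; congr (_ + _).
    by case: ifP => // _; rewrite scaler0 scale0r.
  by case: ifP => // _; rewrite ?scalerN // scaler0 scale0r oppr0.
- by move=> j /negPf ej; rewrite mxE ej subr0; case: ifP.
- by move=> j /negPf ej /negPf ij; rewrite mxE ej ij subr0.
Qed.

(** * Coordinates of the constraint space *)

Section Coordinates.
Variables mE mI mC : nat.

Definition idx_h (i : 'I_mE) : 'I_(mE + mI + mC * 2) :=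
  lshift (mC * 2) (lshift mI i).
Definition idx_g (i : 'I_mI) : 'I_(mE + mI + mC * 2) :=
  lshift (mC * 2) (rshift mE i).
Definition idx_G (i : 'I_mC) : 'I_(mE + mI + mC * 2) :=
  rshift (mE + mI) (mxvec_index i 0).
Definition idx_H (i : 'I_mC) : 'I_(mE + mI + mC * 2) :=
  rshift (mE + mI) (mxvec_index i 1).

Lemma idx_ind (P : 'I_(mE + mI + mC * 2) -> Prop) :
  (forall i, P (idx_h i)) -> (forall i, P (idx_g i)) ->
  (forall i, P (idx_G i)) -> (forall i, P (idx_H i)) -> forall j, P j.
Proof.
move=> Ph Pg PG PH j; case: (split_ordP j) => k ->.
  by case: (split_ordP k) => i ->; [exact: Ph | exact: Pg].
case/mxvec_indexP: k => i b; have [->|->] : b = 0 \/ b = 1; [|exact: PG|exact: PH].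
by case: b => [[|[|//]] ?]; [left | right]; apply: val_inj.
Qed.

Lemma big_idx (V : nmodType) (F : 'I_(mE + mI + mC * 2) -> V) :
  \sum_j F j = \sum_i F (idx_h i) + \sum_i F (idx_g i)
               + \sum_i (F (idx_G i) + F (idx_H i)).
Proof.
rewrite !big_split_ord /=; congr (_ + _).
rewrite (reindex _ (curry_mxvec_bij _ _)) /=.
rewrite (eq_bigr (fun p => F (rshift (mE + mI) (mxvec_index p.1 p.2)))).
  rewrite -(pair_bigA _ (fun i b => F (rshift (mE + mI) (mxvec_index i b)))) /=.
  apply: eq_bigr => i _; rewrite !big_ord_recl big_ord0 addr0.
  by congr (F (rshift _ (mxvec_index _ _)) + F (rshift _ (mxvec_index _ _)));
    apply: val_inj.
by case.
Qed.

(** The layout of [mpcc_F], over an arbitrary type of entries: it is also used to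
tabulate boolean conditions on the constraints. *)
Definition mpcc_row (T : Type) (a : 'rV[T]_mE) (b : 'rV[T]_mI)
    (c d : 'rV[T]_mC) : 'rV[T]_(mE + mI + mC * 2) :=
  row_mx (row_mx a b)
    (mxvec (\matrix_(i < mC, j < 2) (if j == 0 then c 0 i else d 0 i))).

Lemma mpcc_rowE (T : Type) (a : 'rV[T]_mE) (b : 'rV[T]_mI) (c d : 'rV[T]_mC) :
  [/\ forall i, mpcc_row a b c d 0 (idx_h i) = a 0 i,
      forall i, mpcc_row a b c d 0 (idx_g i) = b 0 i,
      forall i, mpcc_row a b c d 0 (idx_G i) = c 0 i &
      forall i, mpcc_row a b c d 0 (idx_H i) = d 0 i].
Proof.
by split=> i; rewrite /mpcc_row ?(row_mxEl, row_mxEr, mxvecE) ?mxE.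
Qed.

End Coordinates.
Arguments idx_h {mE mI mC}.
Arguments idx_g {mE mI mC}.
Arguments idx_G {mE mI mC}.
Arguments idx_H {mE mI mC}.

Lemma mpcc_FE (R : realType) (n mE mI mC : nat)
    (h : 'rV[R]_n -> 'rV[R]_mE) (g : 'rV[R]_n -> 'rV[R]_mI)
    (G H : 'rV[R]_n -> 'rV[R]_mC) (x : 'rV[R]_n) :
  [/\ forall i, mpcc_F h g G H x 0 (idx_h i) = h x 0 i,
      forall i, mpcc_F h g G H x 0 (idx_g i) = g x 0 i,
      forall i, mpcc_F h g G H x 0 (idx_G i) = - G x 0 i &
      forall i, mpcc_F h g G H x 0 (idx_H i) = - H x 0 i].
Proof.
by split=> i; rewrite /mpcc_F ?(row_mxEl, row_mxEr, mxvecE) ?mxE.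
Qed.

Lemma mpcc_DP (R : realType) (mE mI mC : nat)
    (y : 'rV[R]_(mE + mI + mC * 2)) :
  mpcc_D R mE mI mC y <->
  [/\ forall i, y 0 (idx_h i) = 0,
      forall i, y 0 (idx_g i) <= 0 &
      forall i, D_C (y 0 (idx_G i), y 0 (idx_H i))].
Proof.
split=> [[yh yg yGH]|[yh yg yGH]]; split.
- by move=> i; move/rowP: yh => /(_ i); rewrite !mxE.
- by move=> i; move: (yg i); rewrite !mxE.
- by move=> i; move: (yGH i); rewrite !mxE.
- by apply/rowP => i; move: (yh i); rewrite !mxE.
- by move=> i; move: (yg i); rewrite !mxE.
- by move=> i; move: (yGH i); rewrite !mxE.
Qed.

(** * Gradients of the constraint map *)

Lemma differentiable_row (R : realType) (n m : nat)
    (f : 'rV[R]_n -> 'rV[R]_m) (x : 'rV[R]_n) :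
  (forall j, differentiable (fun z => f z 0 j) x) -> differentiable f x.
Proof.
move=> df; have -> : f = \sum_(j < m) (fun z => f z 0 j *: delta_mx 0 j).
  by apply/funext => z; rewrite fct_sumE -row_sum_delta.
by apply: differentiable_sum => j; apply: differentiableZl.
Qed.

Lemma differentiable_entry (R : realType) (n m : nat)
    (f : 'rV[R]_n -> 'rV[R]_m) (x : 'rV[R]_n) (j : 'I_m) :
  differentiable f x -> differentiable (fun z => f z 0 j) x.
Proof.
move=> df; apply: (@differentiable_comp _ _ _ _ f
  (fun y : 'rV[R]_m => y 0 j) x df); exact: differentiable_coord.
Qed.

Lemma diff_coord (R : realType) (n m : nat)
    (f : 'rV[R]_n -> 'rV[R]_m) (x u : 'rV[R]_n) (j : 'I_m) :
  differentiable f x -> 'd f x u 0 j = 'd (fun z => f z 0 j) x u.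
Proof.
move=> df; pose p (N : 'rV[R]_m) : R := N 0 j.
have plin : linear p by move=> c a b; rewrite /p !mxE.
pose plM := GRing.isLinear.Build _ _ _ _ _ plin.
pose pL : {linear 'rV[R]_m -> R} := HB.pack p plM.
have pcont : continuous pL by apply: coord_continuous.
have := @diff_comp _ _ _ _ f pL x df (linear_differentiable _ pcont).
by rewrite diff_lin // => /(congr1 (fun k => k u)) /esym.
Qed.

Lemma gradE (R : realType) (n m : nat)
    (f : 'rV[R]_n -> 'rV[R]_m) (x : 'rV[R]_n) (j : 'I_m) :
  differentiable f x ->
  grad f j x = \row_k 'd (fun z => f z 0 j) x (delta_mx 0 k).
Proof. by move=> df; apply/rowP => k; rewrite !mxE diff_coord. Qed.

Lemma grad_eq (R : realType) (n m m' : nat) (f : 'rV[R]_n -> 'rV[R]_m)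
    (f' : 'rV[R]_n -> 'rV[R]_m') (x : 'rV[R]_n) (j : 'I_m) (j' : 'I_m') :
  differentiable f x -> differentiable f' x ->
  (fun z => f z 0 j) = (fun z => f' z 0 j') -> grad f j x = grad f' j' x.
Proof. by move=> df df' ff'; rewrite (gradE _ df) (gradE _ df') ff'. Qed.

Lemma grad_eqN (R : realType) (n m m' : nat) (f : 'rV[R]_n -> 'rV[R]_m)
    (f' : 'rV[R]_n -> 'rV[R]_m') (x : 'rV[R]_n) (j : 'I_m) (j' : 'I_m') :
  differentiable f x -> differentiable f' x ->
  (fun z => f z 0 j) = - (fun z => f' z 0 j') -> grad f j x = - grad f' j' x.
Proof.
move=> df df' ff'; rewrite (gradE _ df) (gradE _ df') ff'.
apply/rowP => k; rewrite mxE [RHS]mxE [in RHS]mxE diffN //.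
exact: differentiable_entry.
Qed.

Lemma grad_mpcc_F (R : realType) (n mE mI mC : nat)
    (h : 'rV[R]_n -> 'rV[R]_mE) (g : 'rV[R]_n -> 'rV[R]_mI)
    (G H : 'rV[R]_n -> 'rV[R]_mC) (x : 'rV[R]_n) :
  differentiable h x -> differentiable g x ->
  differentiable G x -> differentiable H x ->
  [/\ forall i, grad (mpcc_F h g G H) (idx_h i) x = grad h i x,
      forall i, grad (mpcc_F h g G H) (idx_g i) x = grad g i x,
      forall i, grad (mpcc_F h g G H) (idx_G i) x = - grad G i x &
      forall i, grad (mpcc_F h g G H) (idx_H i) x = - grad H i x].
Proof.
move=> dh dg dG dH.
have Fh i : (fun z => mpcc_F h g G H z 0 (idx_h i)) = (fun z => h z 0 i).
  by apply/funext => z; have [-> _ _ _] := mpcc_FE h g G H z.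
have Fg i : (fun z => mpcc_F h g G H z 0 (idx_g i)) = (fun z => g z 0 i).
  by apply/funext => z; have [_ -> _ _] := mpcc_FE h g G H z.
have FG i : (fun z => mpcc_F h g G H z 0 (idx_G i)) = - (fun z => G z 0 i).
  by apply/funext => z; have [_ _ -> _] := mpcc_FE h g G H z.
have FH i : (fun z => mpcc_F h g G H z 0 (idx_H i)) = - (fun z => H z 0 i).
  by apply/funext => z; have [_ _ _ ->] := mpcc_FE h g G H z.
have dF : differentiable (mpcc_F h g G H) x.
  apply: differentiable_row; elim/idx_ind => i;
    [rewrite Fh | rewrite Fg | rewrite FG | rewrite FH];
    do ?apply: differentiableN; exact: differentiable_entry.
split=> i.
- exact: grad_eq dF dh (Fh i).
- exact: grad_eq dF dg (Fg i).
- exact: grad_eqN dF dG (FG i).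
- exact: grad_eqN dF dH (FH i).
Qed.

(** * Tangent and normal vectors of D *)

(** Complementarity is deliberately lost where both coordinates of a pair vanish:
there D_C and its convex hull, the quadrant, have the same polar, so these
conditions are enough to recognize normal vectors. *)
Lemma tangent_mpcc_D (R : realType) (mE mI mC : nat)
    (y v : 'rV[R]_(mE + mI + mC * 2)) :
  tangent_cone (mpcc_D R mE mI mC) y v ->
  [/\ forall i, y 0 (idx_g i) = 0 -> v 0 (idx_g i) <= 0,
      forall i, y 0 (idx_G i) = 0 -> v 0 (idx_G i) <= 0,
      forall i, y 0 (idx_H i) = 0 -> v 0 (idx_H i) <= 0,
      forall i, y 0 (idx_H i) < 0 -> y 0 (idx_G i) = 0 -> v 0 (idx_G i) = 0 &
      forall i, y 0 (idx_G i) < 0 -> y 0 (idx_H i) = 0 -> v 0 (idx_H i) = 0] /\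
  (forall i, y 0 (idx_h i) = 0 -> v 0 (idx_h i) = 0).
Proof.
move=> [t [w [t_gt0 t0 wv /(_ _)/mpcc_DP yD]]].
have wvj j : (fun k => w k 0 j) @ \oo --> v 0 j.
  by move: (@coord_continuous R 1 _ 0 j v) => /(continuous_cvg _); apply.
have ywv j : (fun k => (y + t k *: w k) 0 j) @ \oo --> y 0 j.
  rewrite (_ : (fun k => _) = fun k => y 0 j + t k * w k 0 j); last first.
    by apply/funext => k; rewrite !mxE.
  suff : (fun k => y 0 j + t k * w k 0 j) @ \oo --> y 0 j + 0 * v 0 j.
    by rewrite mul0r addr0.
  by apply: cvgD; [exact: cvg_cst | exact: cvgM].
have le_lim j : y 0 j = 0 -> (forall k, (y + t k *: w k) 0 j <= 0) ->
    v 0 j <= 0.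
  move=> yj le0; rewrite leNgt; apply/negP => v_gt0.
  have [k _ /(_ _ (leqnn k))] := cvgr_gt _ (wvj j) _ v_gt0.
  rewrite /= => wk; have := le0 k.
  by rewrite !mxE yj add0r leNgt mulr_gt0.
have eq_lim j : y 0 j = 0 ->
    (\forall k \near \oo, (y + t k *: w k) 0 j = 0) -> v 0 j = 0.
  move=> yj eq0; apply: (cvg_unique _ (wvj j)) => //.
  apply: cvg_near_cst; near=> k.
  have : (y + t k *: w k) 0 j = 0 by near: k.
  by rewrite !mxE yj add0r => /eqP; rewrite mulf_eq0 gt_eqF //= => /eqP.
split; first split.
- by move=> i yi; apply: le_lim => // k; have [_ + _] := yD k; apply.
- by move=> i yi; apply: le_lim => // k; have [_ _ /(_ i)[]] := yD k.
- by move=> i yi; apply: le_lim => // k; have [_ _ /(_ i)[]] := yD k.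
- move=> i yH yG; apply: eq_lim => //; near=> k.
  have [_ _ /(_ i)[_ _ /= /eqP]] := yD k.
  rewrite mulf_eq0 => /orP[/eqP//|/eqP wH].
  suff : (y + t k *: w k) 0 (idx_H i) < 0 by rewrite wH ltxx.
  by near: k; exact: cvgr_lt (ywv _) _ yH.
- move=> i yG yH; apply: eq_lim => //; near=> k.
  have [_ _ /(_ i)[_ _ /= /eqP]] := yD k.
  rewrite mulf_eq0 => /orP[/eqP wG|/eqP//].
  suff : (y + t k *: w k) 0 (idx_G i) < 0 by rewrite wG ltxx.
  by near: k; exact: cvgr_lt (ywv _) _ yG.
- move=> i yi; apply: eq_lim => //; near=> k.
  by have [+ _ _] := yD k; apply.
Unshelve. all: by end_near.
Qed.

Lemma tangent_of_near (R : realType) d (Gamma : set 'rV[R]_d) (z v : 'rV[R]_d) :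
  (\forall k \near \oo, Gamma (z + harmonic k *: v)) -> tangent_cone Gamma z v.
Proof.
move=> [N _ zv]; exists (fun k => harmonic (k + N)%N), (fun=> v); split.
- by move=> k; apply: harmonic_gt0.
- have := @cvg_harmonic R; rewrite -(cvg_shiftn N); exact.
- exact: cvg_cst.
- by move=> k; apply: zv; rewrite /= leq_addl.
Qed.

(** Along the ray from [y] in direction [v], negative entries stay negative for
small steps, and the hypotheses take care of the zero entries. *)
Lemma mem_tangent_mpcc_D (R : realType) (mE mI mC : nat)
    (y v : 'rV[R]_(mE + mI + mC * 2)) :
  mpcc_D R mE mI mC y ->
  (forall i, v 0 (idx_h i) = 0) ->
  (forall i, y 0 (idx_g i) = 0 -> v 0 (idx_g i) <= 0) ->
  (forall i, y 0 (idx_G i) = 0 -> v 0 (idx_G i) <= 0) ->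
  (forall i, y 0 (idx_H i) = 0 -> v 0 (idx_H i) <= 0) ->
  (forall i, y 0 (idx_H i) < 0 -> v 0 (idx_G i) = 0) ->
  (forall i, y 0 (idx_G i) < 0 -> v 0 (idx_H i) = 0) ->
  (forall i, y 0 (idx_G i) = 0 -> y 0 (idx_H i) = 0 ->
     v 0 (idx_G i) * v 0 (idx_H i) = 0) ->
  tangent_cone (mpcc_D R mE mI mC) y v.
Proof.
move=> /mpcc_DP[yh yg yGH] vh vg vG vH vG0 vH0 vGH.
have le_near j : y 0 j <= 0 -> (y 0 j = 0 -> v 0 j <= 0) ->
    \forall k \near \oo, (y + harmonic k *: v) 0 j <= 0.
  rewrite le_eqVlt => /predU1P[yj /(_ yj) vj|yj _].
    near=> k; rewrite !mxE yj add0r mulr_ge0_le0 //; exact: harmonic_ge0.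
  have : (fun k => y 0 j + harmonic k * v 0 j) @ \oo --> y 0 j + 0 * v 0 j.
    by apply: cvgD; [exact: cvg_cst | apply: cvgM; [exact: cvg_harmonic | exact: cvg_cst]].
  rewrite mul0r addr0 => /cvgr_lt /(_ _ yj); apply: filterS => k yk.
  by rewrite !mxE ltW.
apply: tangent_of_near.
have near_g : \forall k \near \oo, forall i : 'I_mI,
    (y + harmonic k *: v) 0 (idx_g i) <= 0.
  by apply: filter_forall => i; apply: le_near; [apply: yg | apply: vg].
have near_G : \forall k \near \oo, forall i : 'I_mC,
    (y + harmonic k *: v) 0 (idx_G i) <= 0.
  by apply: filter_forall => i; apply: le_near; [case: (yGH i) | apply: vG].
have near_H : \forall k \near \oo, forall i : 'I_mC,
    (y + harmonic k *: v) 0 (idx_H i) <= 0.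
  by apply: filter_forall => i; apply: le_near; [case: (yGH i) | apply: vH].
near=> k; apply/mpcc_DP; split.
- by move=> i; rewrite !mxE yh vh mulr0 addr0.
- by near: k.
move=> i; split; rewrite /=; [by move: i; near: k..|].
case: (yGH i) => /= yG yH yGH0; rewrite !mxE.
move: yG; rewrite le_eqVlt => /predU1P[yG|yG].
  move: yH; rewrite le_eqVlt => /predU1P[yH|yH].
    by rewrite yG yH !add0r mulrACA vGH // mulr0.
  by rewrite vG0 // yG mulr0 addr0 mul0r.
have yH0 : y 0 (idx_H i) = 0.
  by move/eqP: yGH0; rewrite mulf_eq0 lt_eqF //= => /eqP.
by rewrite vH0 // yH0 mulr0 addr0 mulr0.
Unshelve. all: by end_near.
Qed.

Lemma normal_mpcc_D (R : realType) (mE mI mC : nat)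
    (z y : 'rV[R]_(mE + mI + mC * 2)) :
  mpcc_D R mE mI mC z ->
  (forall i, 0 <= y 0 (idx_g i)) ->
  (forall i, z 0 (idx_g i) <> 0 -> y 0 (idx_g i) = 0) ->
  (forall i, z 0 (idx_G i) < 0 -> y 0 (idx_G i) = 0) ->
  (forall i, z 0 (idx_H i) < 0 -> y 0 (idx_H i) = 0) ->
  (forall i, z 0 (idx_G i) = 0 -> z 0 (idx_H i) = 0 ->
     0 <= y 0 (idx_G i) /\ 0 <= y 0 (idx_H i)) ->
  regular_normal_cone (mpcc_D R mE mI mC) z y.
Proof.
move=> /mpcc_DP[zh zg zGH] yg yg0 yG0 yH0 yGH v.
move=> /tangent_mpcc_D[[vg vG vH vG0 vH0] vh].
rewrite /dot big_idx big1 ?add0r => [|i _]; last by rewrite vh ?zh ?mulr0.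
rewrite -[leRHS]addr0; apply: lerD; apply: sumr_le0 => i _.
  case: (eqVneq (z 0 (idx_g i)) 0) => [/vg v_le0|/eqP/yg0->].
    exact: mulr_ge0_le0.
  by rewrite mul0r.
have [/= + + /eqP] := zGH i.
rewrite mulf_eq0 [z 0 (idx_G i) <= 0]le_eqVlt [z 0 (idx_H i) <= 0]le_eqVlt.
move=> /predU1P[zG|zG] /predU1P[zH|zH].
- have [yG yH] := yGH i zG zH.
  move=> _; rewrite -[leRHS]addr0.
  by apply: lerD; apply: mulr_ge0_le0 => //; [apply: vG|apply: vH].
- by rewrite vG0 // yH0 // mulr0 mul0r addr0.
- by rewrite vH0 // yG0 // mulr0 mul0r addr0.
- by rewrite !lt_eqF.
Qed.

(** * Choosing between the two multipliers *)

(** The pairs (p1, q1) and (p2, q2) are the G- and H-entries of two multipliers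
of the same vector. A negative p1 on B1, or a negative q1 on B2, makes the
difference of the multipliers negative at that index; by the sign conditions the
first multiplier is then at most the second one wherever the latter is not known
to be nonnegative, namely for q2 on B1 and for p2 on B2. *)
Lemma nonneg_dichotomy (R : realType) (I : Type) (B1 B2 : set I)
    (p1 q1 p2 q2 : I -> R) :
  (forall i, B2 i -> 0 <= p1 i) -> (forall i, B1 i -> 0 <= q1 i) ->
  (forall i, B1 i -> 0 <= p2 i) -> (forall i, B2 i -> 0 <= q2 i) ->
  (forall i i', B1 i -> B2 i' -> 0 <= (p1 i - p2 i) * (p1 i' - p2 i') /\
                                 0 <= (q1 i - q2 i) * (q1 i' - q2 i')) ->
  (forall i i', B1 i -> B1 i' -> 0 <= (p1 i - p2 i) * (q1 i' - q2 i')) ->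
  (forall i i', B2 i -> B2 i' -> 0 <= (p1 i - p2 i) * (q1 i' - q2 i')) ->
  (forall i, (B1 `|` B2) i -> 0 <= p1 i /\ 0 <= q1 i) \/
  (forall i, (B1 `|` B2) i -> 0 <= p2 i /\ 0 <= q2 i).
Proof.
move=> p1B2 q1B1 p2B1 q2B2 s12 s11 s22.
have le_of_sign (a1 a2 b1 b2 : R) : a1 < 0 -> 0 <= a2 ->
    0 <= (a1 - a2) * (b1 - b2) -> b1 <= b2.
  move=> a1_lt0 a2_ge0; rewrite nmulr_rge0 ?subr_le0 //.
  by rewrite subr_lt0 (lt_le_trans a1_lt0).
case: (pselect (forall i, B1 i -> 0 <= p1 i)) => [p1B1|].
  case: (pselect (forall i, B2 i -> 0 <= q1 i)) => [q1B2|].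
    by left=> i [Bi|Bi]; split; auto.
  move=> /existsNP[i /not_implyP[Bi /negP]]; rewrite -ltNge => q1i.
  right=> j [Bj|Bj]; split; auto.
    apply: le_trans (q1B1 j Bj) _; apply: le_of_sign q1i (q2B2 i Bi) _.
    by rewrite mulrC; apply: (s12 _ _ Bj Bi).2.
  apply: le_trans (p1B2 j Bj) _; apply: le_of_sign q1i (q2B2 i Bi) _.
  by rewrite mulrC; apply: s22.
move=> /existsNP[i /not_implyP[Bi /negP]]; rewrite -ltNge => p1i.
right=> j [Bj|Bj]; split; auto.
  apply: le_trans (q1B1 j Bj) _; apply: le_of_sign p1i (p2B1 i Bi) _.
  exact: s11.
apply: le_trans (p1B2 j Bj) _; apply: le_of_sign p1i (p2B1 i Bi) _.
exact: (s12 _ _ Bi Bj).1.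
Qed.

(** * The linearized cone *)

Lemma opp_comb (K : pzRingType) (V : lmodType K) (a b : K) (p q : V) :
  - (a *: p + b *: q) = a *: - p + b *: - q.
Proof. by rewrite opprD !scalerN. Qed.

Lemma row_nabla (R : realType) (n m : nat) (f : 'rV[R]_n -> 'rV[R]_m)
    (x : 'rV[R]_n) (i : 'I_m) : row i (nabla f x) = grad f i x.
Proof. by []. Qed.

Section Linearization.
Variables (R : realType) (n mE mI mC : nat).
Variables (h : 'rV[R]_n -> 'rV[R]_mE) (g : 'rV[R]_n -> 'rV[R]_mI).
Variables (G H : 'rV[R]_n -> 'rV[R]_mC) (x : 'rV[R]_n).
Hypotheses (dh : differentiable h x) (dg : differentiable g x).
Hypotheses (dG : differentiable G x) (dH : differentiable H x).
Hypothesis x_feasible : Omega_C h g G H x.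

Let F := mpcc_F h g G H.

Lemma mul_nabla_mpcc_F (u : 'rV[R]_n) :
  [/\ forall i, (u *m (nabla F x)^T) 0 (idx_h i) = dot (grad h i x) u,
      forall i, (u *m (nabla F x)^T) 0 (idx_g i) = dot (grad g i x) u,
      forall i, (u *m (nabla F x)^T) 0 (idx_G i) = - dot (grad G i x) u &
      forall i, (u *m (nabla F x)^T) 0 (idx_H i) = - dot (grad H i x) u].
Proof.
have [eh eg eG eH] := grad_mpcc_F dh dg dG dH.
by split=> i; rewrite -dot_row row_nabla ?(eh, eg) // ?eG ?eH dotNl.
Qed.

Lemma complementarity_cases (i : 'I_mC) :
  [\/ I_00 G H x i, I_0p G H x i | I_p0 G H x i].
Proof.
have [_ _ FGi FHi] := mpcc_FE h g G H x.
have /mpcc_DP[_ _ /(_ i)[/=]] := x_feasible.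
rewrite FGi FHi !oppr_le0 mulrNN => + + /eqP.
rewrite mulf_eq0 !le_eqVlt => /predU1P[Gi|Gi] /predU1P[Hi|Hi].
- by move=> _; constructor 1; split.
- by move=> _; constructor 2; split.
- by move=> _; constructor 3; split.
- by rewrite !gt_eqF.
Qed.

(** Complementarity need only be imposed on beta^GH: at any other index of I^00
one of the two derivatives vanishes on the whole solution set. *)
Lemma linear_system_tangent (u : 'rV[R]_n) :
  linear_system h g G H x u ->
  (forall i, beta_GH h g G H x i ->
     dot (grad G i x) u * dot (grad H i x) u = 0) ->
  tangent_cone (mpcc_D R mE mI mC) (F x) (u *m (nabla F x)^T).
Proof.
move=> Su prod0; have [uh ug uG uH uGH] := Su.
have [eh eg eG eH] := mul_nabla_mpcc_F u.
have [Fh Fg FG FH] := mpcc_FE h g G H x.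
apply: mem_tangent_mpcc_D => // i.
- by rewrite eh dot_row uh mxE.
- by rewrite eg Fg => /ug.
- rewrite eG FG => /eqP; rewrite oppr_eq0 => /eqP Gi.
  have [I00|I0p|[]] := complementarity_cases i; last by rewrite Gi ltxx.
    exact: (uGH i I00).1.
  by rewrite (uG i I0p).
- rewrite eH FH => /eqP; rewrite oppr_eq0 => /eqP Hi.
  have [I00|[]|Ip0] := complementarity_cases i; first exact: (uGH i I00).2.
    by rewrite Hi ltxx.
  by rewrite (uH i Ip0).
- rewrite eG FH oppr_lt0 => Hi.
  have [[_ H0]|I0p|[_ H0]] := complementarity_cases i;
    [by rewrite H0 ltxx in Hi | exact: uG | by rewrite H0 ltxx in Hi].
- rewrite eH FG oppr_lt0 => Gi.
  have [[G0 _]|[G0 _]|Ip0] := complementarity_cases i;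
    [by rewrite G0 ltxx in Gi | by rewrite G0 ltxx in Gi | exact: uH].
- rewrite eG eH FG FH mulrNN => /eqP Gi /eqP Hi.
  have I00 : I_00 G H x i by split; apply/eqP; rewrite -oppr_eq0.
  have [uGi uHi] := uGH i I00.
  apply/eqP; rewrite mulf_eq0.
  case: (pselect (beta_G h g G H x i)) => [bG|nbG].
    case: (pselect (beta_H h g G H x i)) => [bH|nbH].
      by rewrite -mulf_eq0; apply/eqP; apply: prod0; split.
    apply/orP; right; rewrite -oppr_eq0; apply: contra_notT nbH => uHi0.
    split; first exact: I00.
    by exists u; [exact: Su | rewrite lt_neqAle uHi0 uHi].
  apply/orP; left; rewrite -oppr_eq0; apply: contra_notT nbG => uGi0.
  split; first exact: I00.
  by exists u; [exact: Su | rewrite lt_neqAle uGi0 uGi].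
Qed.

(** Farkas' lemma for the linear system with the G-inequalities of [A] and the
H-inequalities of [B] turned into equalities; only the multipliers of these
inequalities lose their sign. *)
Lemma branch_multiplier (A B : set 'I_mC) (w : 'rV[R]_n) :
  A `<=` I_00 G H x -> B `<=` I_00 G H x ->
  (forall u, linear_system h g G H x u ->
     (forall i, A i -> dot (grad G i x) u = 0) ->
     (forall i, B i -> dot (grad H i x) u = 0) -> dot w u <= 0) ->
  exists y : 'rV[R]_(mE + mI + mC * 2),
    [/\ w = y *m nabla F x,
        (forall i, 0 <= y 0 (idx_g i)) /\
        (forall i, ~ I_g g x i -> y 0 (idx_g i) = 0),
        (forall i, I_p0 G H x i -> y 0 (idx_G i) = 0) /\
        (forall i, I_0p G H x i -> y 0 (idx_H i) = 0),
        forall i, I_00 G H x i -> ~ A i -> 0 <= y 0 (idx_G i) &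
        forall i, I_00 G H x i -> ~ B i -> 0 <= y 0 (idx_H i)].
Proof.
move=> A00 B00 wpolar.
pose eqs : 'rV[bool]_(mE + mI + mC * 2) :=
  mpcc_row (const_mx true) (const_mx false)
    (\row_i `[< I_0p G H x i \/ A i >]) (\row_i `[< I_p0 G H x i \/ B i >]).
pose ineqs : 'rV[bool]_(mE + mI + mC * 2) :=
  mpcc_row (const_mx false) (\row_i `[< I_g g x i >])
    (\row_i `[< I_00 G H x i >]) (\row_i `[< I_00 G H x i >]).
have [eqh eqg eqG eqH] : [/\ forall i, eqs 0 (idx_h i) = true,
    forall i, eqs 0 (idx_g i) = false,
    forall i, eqs 0 (idx_G i) = `[< I_0p G H x i \/ A i >] &
    forall i, eqs 0 (idx_H i) = `[< I_p0 G H x i \/ B i >]].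
  have [a b c d] := mpcc_rowE (const_mx true : 'rV_mE) (const_mx false : 'rV_mI)
    (\row_i `[< I_0p G H x i \/ A i >]) (\row_i `[< I_p0 G H x i \/ B i >]).
  by split=> i; rewrite ?(a, b, c, d) mxE.
have [inh ing inG inH] : [/\ forall i, ineqs 0 (idx_h i) = false,
    forall i, ineqs 0 (idx_g i) = `[< I_g g x i >],
    forall i, ineqs 0 (idx_G i) = `[< I_00 G H x i >] &
    forall i, ineqs 0 (idx_H i) = `[< I_00 G H x i >]].
  have [a b c d] := mpcc_rowE (const_mx false : 'rV_mE)
    (\row_i `[< I_g g x i >]) (\row_i `[< I_00 G H x i >])
    (\row_i `[< I_00 G H x i >]).
  by split=> i; rewrite ?(a, b, c, d) mxE.
have [u ueq uin|y [yE y_ge0 y0]] :=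
    @farkas R _ _ (nabla F x) (eqs 0) (ineqs 0) w.
  have [eh eg eG eH] := mul_nabla_mpcc_F u.
  apply: wpolar.
  - split.
    + apply/rowP => i; rewrite -dot_row mxE row_nabla.
      by rewrite -eh -dot_row ueq ?eqh.
    + by move=> i Ii; rewrite -eg -dot_row uin // ing; apply/asboolP.
    + move=> i Ii; rewrite -eG -dot_row ueq // eqG.
      by apply/asboolP; left.
    + move=> i Ii; rewrite -eH -dot_row ueq // eqH.
      by apply/asboolP; left.
    + move=> i Ii; split.
        by rewrite -eG -dot_row uin // inG; apply/asboolP.
      by rewrite -eH -dot_row uin // inH; apply/asboolP.
  - move=> i Ai; apply/eqP; rewrite -oppr_eq0 -eG -dot_row ueq // eqG.
    by apply/asboolP; right.
  - move=> i Bi; apply/eqP; rewrite -oppr_eq0 -eH -dot_row ueq // eqH.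
    by apply/asboolP; right.
exists y; split=> //.
- split=> i; first by apply: y_ge0; rewrite eqg.
  by move=> nIi; apply: y0; rewrite ?eqg // ing; apply/asboolPn.
- split=> i [Gi Hi]; apply: y0.
  + rewrite eqG; apply/asboolPn => -[[Gi0 _]|/A00[Gi0 _]];
      by rewrite Gi0 ltxx in Gi.
  + by rewrite inG; apply/asboolPn => -[Gi0 _]; rewrite Gi0 ltxx in Gi.
  + rewrite eqH; apply/asboolPn => -[[_ Hi0]|/B00[_ Hi0]];
      by rewrite Hi0 ltxx in Hi.
  + by rewrite inH; apply/asboolPn => -[_ Hi0]; rewrite Hi0 ltxx in Hi.
- move=> i [Gi Hi] nAi; apply: y_ge0; rewrite eqG.
  by apply/asboolPn => -[[_]|//]; rewrite Hi ltxx.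
- move=> i [Gi Hi] nBi; apply: y_ge0; rewrite eqH.
  by apply/asboolPn => -[[+ _]|//]; rewrite Gi ltxx.
Qed.

(** The minus signs on the G- and H-blocks of F are those in the definition of
[N_CC], so the blocks of [y] are multipliers without any change of sign. *)
Lemma kernel_N_CC (y : 'rV[R]_(mE + mI + mC * 2)) :
  y *m nabla F x = 0 ->
  (forall i, ~ I_g g x i -> y 0 (idx_g i) = 0) ->
  (forall i, I_p0 G H x i -> y 0 (idx_G i) = 0) ->
  (forall i, I_0p G H x i -> y 0 (idx_H i) = 0) ->
  N_CC h g G H x (\row_i y 0 (idx_h i), \row_i y 0 (idx_g i),
                  \row_i y 0 (idx_G i), \row_i y 0 (idx_H i)).
Proof.
move=> yF0 yg yG yH; have [eh eg eG eH] := grad_mpcc_F dh dg dG dH.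
split.
  by split=> i Ii; rewrite mxE; [apply: yg | apply: yG | apply: yH].
rewrite /= -[RHS]yF0 mulmx_sum_row big_idx -sumrN; congr (_ + _ + _).
- by apply: eq_bigr => i _; rewrite mxE -eh.
- by apply: eq_bigr => i _; rewrite mxE -eg.
- apply: eq_bigr => i _; rewrite !mxE; apply: etrans (opp_comb _ _ _ _) _.
  exact: (congr2 (fun p q => y 0 (idx_G i) *: p + y 0 (idx_H i) *: q)
    (esym (eG i)) (esym (eH i))).
Qed.

End Linearization.

Unset Implicit Arguments.
Set Strict Implicit.

Theorem corollary5 (R : realType) (n mE mI mC : nat)
    (f : 'rV[R]_n -> R)
    (h : 'rV[R]_n -> 'rV[R]_mE) (g : 'rV[R]_n -> 'rV[R]_mI)
    (G H : 'rV[R]_n -> 'rV[R]_mC)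
    (f_C1 : continuously_differentiable f)
    (h_C1 : continuously_differentiable h)
    (g_C1 : continuously_differentiable g)
    (G_C1 : continuously_differentiable G)
    (H_C1 : continuously_differentiable H)
    (xbar : 'rV[R]_n)
    (xbar_feasible : Omega_C h g G H xbar)
    (ggcq : GGCQ h g G H xbar)
    (partition_cond : exists beta1 beta2 : set 'I_mC,
       bipartition (beta_GH h g G H xbar) beta1 beta2 /\
       forall (muh : 'rV[R]_mE) (mug : 'rV[R]_mI) (muG muH : 'rV[R]_mC),
         N_CC h g G H xbar (muh, mug, muG, muH) ->
         [/\ forall i i', beta1 i -> beta2 i' ->
               0 <= muG 0 i * muG 0 i' /\ 0 <= muH 0 i * muH 0 i',
             forall i i', beta1 i -> beta1 i' -> 0 <= muG 0 i * muH 0 i' &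
             forall i i', beta2 i -> beta2 i' -> 0 <= muG 0 i * muH 0 i']) :
  regular_normal_cone (Omega_C h g G H) xbar =
  [set y *m nabla (mpcc_F h g G H) xbar
     | y in regular_normal_cone (mpcc_D R mE mI mC) (mpcc_F h g G H xbar)].
Proof.
have dh := h_C1.1 xbar; have dg := g_C1.1 xbar.
have dG := G_C1.1 xbar; have dH := H_C1.1 xbar.
have [Fh Fg FG FH] := mpcc_FE h g G H xbar.
have [B1 [B2 [[B120 B12] signs]]] := partition_cond.
rewrite /regular_normal_cone ggcq; apply/seteqP; split=> w; last first.
  by move=> [y yN <-] u Lu; rewrite dot_mulmx; exact: (yN _ Lu).
move=> wL.
have B100 : B1 `<=` I_00 G H xbar.
  move=> i Bi; have [[]] : beta_GH h g G H xbar i by rewrite -B12; left.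
  exact.
have B200 : B2 `<=` I_00 G H xbar.
  move=> i Bi; have [[]] : beta_GH h g G H xbar i by rewrite -B12; right.
  exact.
(* First piece: dG u = 0 on B1 and dH u = 0 on B2. *)
have [u Su uG uH|y1 [w1 [y1g y1g0] [y1p y1q] y1G y1H]] :=
    branch_multiplier dh dg dG dH B100 B200 (w := w).
  apply: wL; apply: linear_system_tangent => // i; rewrite -B12.
  by move=> Bi; apply/eqP; rewrite mulf_eq0; apply/orP; case: Bi => Bi;
    [left; apply/eqP; apply: uG | right; apply/eqP; apply: uH].
(* Second piece: the roles of G and H are exchanged. *)
have [u Su uG uH|y2 [w2 [y2g y2g0] [y2p y2q] y2G y2H]] :=
    branch_multiplier dh dg dG dH B200 B100 (w := w).
  apply: wL; apply: linear_system_tangent => // i; rewrite -B12.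
  by move=> Bi; apply/eqP; rewrite mulf_eq0; apply/orP; case: Bi => Bi;
    [right; apply/eqP; apply: uH | left; apply/eqP; apply: uG].
have [s12 s11 s22] : [/\ forall i i', B1 i -> B2 i' ->
      0 <= (y1 0 (idx_G i) - y2 0 (idx_G i))
           * (y1 0 (idx_G i') - y2 0 (idx_G i')) /\
      0 <= (y1 0 (idx_H i) - y2 0 (idx_H i))
           * (y1 0 (idx_H i') - y2 0 (idx_H i')),
    forall i i', B1 i -> B1 i' ->
      0 <= (y1 0 (idx_G i) - y2 0 (idx_G i))
           * (y1 0 (idx_H i') - y2 0 (idx_H i')) &
    forall i i', B2 i -> B2 i' ->
      0 <= (y1 0 (idx_G i) - y2 0 (idx_G i))
           * (y1 0 (idx_H i') - y2 0 (idx_H i'))].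
  have diffE j : (y1 - y2) 0 j = y1 0 j - y2 0 j by rewrite !mxE.
  have ker : N_CC h g G H xbar
      (\row_i (y1 - y2) 0 (idx_h i), \row_i (y1 - y2) 0 (idx_g i),
       \row_i (y1 - y2) 0 (idx_G i), \row_i (y1 - y2) 0 (idx_H i)).
    apply: kernel_N_CC => //.
    - by rewrite mulmxBl -w1 -w2 subrr.
    - by move=> i Ii; rewrite diffE y1g0 // y2g0 // subrr.
    - by move=> i Ii; rewrite diffE y1p // y2p // subrr.
    - by move=> i Ii; rewrite diffE y1q // y2q // subrr.
  have [s12 s11 s22] := signs _ _ _ _ ker.
  split=> i i' Bi Bi'; rewrite -!diffE.
  - by have := s12 i i' Bi Bi'; rewrite !mxE.
  - by have := s11 i i' Bi Bi'; rewrite !mxE.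
  - by have := s22 i i' Bi Bi'; rewrite !mxE.
have disj i : B1 i -> ~ B2 i.
  by move=> B1i B2i; have : (B1 `&` B2) i by []; rewrite B120.
have normal_of (y : 'rV[R]_(mE + mI + mC * 2)) :
    (forall i, 0 <= y 0 (idx_g i)) ->
    (forall i, ~ I_g g xbar i -> y 0 (idx_g i) = 0) ->
    (forall i, I_p0 G H xbar i -> y 0 (idx_G i) = 0) ->
    (forall i, I_0p G H xbar i -> y 0 (idx_H i) = 0) ->
    (forall i, I_00 G H xbar i -> 0 <= y 0 (idx_G i) /\ 0 <= y 0 (idx_H i)) ->
    regular_normal_cone (mpcc_D R mE mI mC) (mpcc_F h g G H xbar) y.
  move=> yg yg0 yp yq y00; apply: normal_mpcc_D => // i.
  - by rewrite Fg => /yg0.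
  - rewrite FG oppr_lt0 => Gi; apply: yp.
    by have [[G0 _]|[G0 _]|//] := complementarity_cases xbar_feasible i;
      rewrite G0 ltxx in Gi.
  - rewrite FH oppr_lt0 => Hi; apply: yq.
    by have [[_ H0]|//|[_ H0]] := complementarity_cases xbar_feasible i;
      rewrite H0 ltxx in Hi.
  - rewrite FG FH => /eqP Gi /eqP Hi; apply: y00.
    by split; apply/eqP; rewrite -oppr_eq0.
have [good|good] := @nonneg_dichotomy R _ B1 B2
    (fun i => y1 0 (idx_G i)) (fun i => y1 0 (idx_H i))
    (fun i => y2 0 (idx_G i)) (fun i => y2 0 (idx_H i))
    (fun i Bi => y1G i (B200 i Bi) (fun Ai => disj i Ai Bi))
    (fun i Bi => y1H i (B100 i Bi) (disj i Bi))
    (fun i Bi => y2G i (B100 i Bi) (disj i Bi))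
    (fun i Bi => y2H i (B200 i Bi) (fun Ai => disj i Ai Bi)) s12 s11 s22.
  exists y1 => //; apply: normal_of => // i I00.
  case: (pselect ((B1 `|` B2) i)) => [/good//|nB].
  by split; [apply: y1G | apply: y1H] => // Bi; apply: nB; [left | right].
exists y2 => //; apply: normal_of => // i I00.
case: (pselect ((B1 `|` B2) i)) => [/good//|nB].
by split; [apply: y2G | apply: y2H] => // Bi; apply: nB; [right | left].
Qed.
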